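(* Let $R$ be a commutative ring with identity and $S$ a multiplicative subset of $R$. (1) If $R$ is $S$-Artinian, then every element of $R$ is $S$-$\pi$-regular; equivalently, the localization $R_S$ is a $\pi$-regular ring. (2) If $R$ is uniformly $S$-Artinian, then $R$ is uniformly $S$-$\pi$-regular.
   Context: A multiplicative subset contains $1$ and is closed under multiplication. For $s\in S$, an element $a\in R$ is $S$-$\pi$-regular with respect to $s$ if there exist $b\in R$ and an integer $n\ge1$ with $sa^n=a^{2n}b$; $a$ is $S$-$\pi$-regular if this holds for some $s\in S$. $R$ is uniformly $S$-$\pi$-regular if there exists $s\in S$ such that every element of $R$ is $S$-$\pi$-regular with respect to $s$. A ring $A$ is $\pi$-regular if for every $a\in A$ there are $n\ge1$ and $x\in A$ with $a^n=xa^{2n}$. A descending sequence $(I_n)_{n\in\mathbb{N}}$ of ideals of $R$ is $S$-stationary with respect to $s\in S$ if there is a positive integer $k$ such that $sI_k\subseteq I_n$ for all $n\ge k$. $R$ is $S$-Artinian if every descending sequence of ideals is $S$-stationary with respect to some $s\in S$ (depending on the sequence); $R$ is uniformly $S$-Artinian if there is a single $s\in S$ such that every descending sequence of ideals is $S$-stationary with respect to $s$. *)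

(* Defs.v *)
From HB Require Import structures.
From mathcomp Require Import all_boot all_algebra.
From mathcomp Require Import boolp classical_sets.
From mathcomp Require Import ring.

Set Implicit Arguments.
Unset Strict Implicit.
Unset Printing Implicit Defensive.

Import GRing.Theory.
Local Open Scope ring_scope.
Local Open Scope quotient_scope.
Local Open Scope classical_set_scope.

(* All rings are [comPzRingType]s: the zero ring is allowed, and neither a
   multiplicative subset nor an ideal is required to be proper (in particular
   [0] may belong to [S], in which case the localization is the zero ring). *)

Definition multiplicative_subset (R : comPzRingType) (S : set R) : Prop :=
  S 1 /\ forall s t, S s -> S t -> S (s * t).

(* MathComp's [idealr_closed] only covers proper ideals given by boolean
   predicates. *)
Definition is_ideal (R : comPzRingType) (I : set R) : Prop :=
  [/\ I 0, forall x y, I x -> I y -> I (x + y)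
         & forall a x, I x -> I (a * x)].

Definition S_pi_regular_wrt (R : comPzRingType) (s a : R) : Prop :=
  exists (b : R) (n : nat), (1 <= n)%N /\ s * a ^+ n = a ^+ (2 * n) * b.

Definition S_pi_regular (R : comPzRingType) (S : set R) (a : R) : Prop :=
  exists2 s, S s & S_pi_regular_wrt s a.

Definition uniformly_S_pi_regular (R : comPzRingType) (S : set R) : Prop :=
  exists2 s, S s & forall a, S_pi_regular_wrt s a.

Definition pi_regular_ring (A : pzRingType) : Prop :=
  forall a : A, exists (n : nat) (x : A), (1 <= n)%N /\ a ^+ n = x * a ^+ (2 * n).

Definition descending_ideals (R : comPzRingType) (I : nat -> set R) : Prop :=
  (forall n, is_ideal (I n)) /\ (forall n, I n.+1 `<=` I n).

Definition S_stationary_wrt (R : comPzRingType) (s : R) (I : nat -> set R) :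
    Prop :=
  exists k : nat, (0 < k)%N /\
    forall n, (k <= n)%N -> [set s * x | x in I k] `<=` I n.

Definition S_Artinian (R : comPzRingType) (S : set R) : Prop :=
  forall I : nat -> set R, descending_ideals I ->
    exists2 s, S s & S_stationary_wrt s I.

Definition uniformly_S_Artinian (R : comPzRingType) (S : set R) : Prop :=
  exists2 s, S s &
    forall I : nat -> set R, descending_ideals I -> S_stationary_wrt s I.

Section Localization.
Variables (R : comPzRingType) (S : set R) (mS : multiplicative_subset S).

Let frac := (R * S)%type.
Implicit Types x y z : frac.

Definition loc_one : S := exist _ 1 (mem_set mS.1).

Definition loc_den_mul (s t : S) : S :=
  exist _ (val s * val t) (mem_set (mS.2 _ _ (set_valP s) (set_valP t))).

Definition loc_eqv x y : bool :=
  `[< exists2 u, S u & u * (x.1 * val y.2) = u * (y.1 * val x.2) >].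

Lemma loc_eqvP x y :
  reflect (exists2 u, S u & u * (x.1 * val y.2) = u * (y.1 * val x.2))
          (loc_eqv x y).
Proof. exact: asboolP. Qed.

Lemma loc_eqv_refl : reflexive loc_eqv.
Proof. by move=> x; apply/loc_eqvP; exists 1 => //; case: mS. Qed.

Lemma loc_eqv_sym : symmetric loc_eqv.
Proof.
by move=> x y; apply/loc_eqvP/loc_eqvP => -[u Su e]; exists u.
Qed.

Lemma loc_eqv_trans : transitive loc_eqv.
Proof.
move=> y x z /loc_eqvP[u Su e1] /loc_eqvP[v Sv e2]; apply/loc_eqvP.
exists (u * v * val y.2).
  by apply: mS.2; [apply: mS.2|exact: set_valP].
have -> : u * v * val y.2 * (x.1 * val z.2)
        = v * val z.2 * (u * (x.1 * val y.2)) by ring.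
have -> : u * v * val y.2 * (z.1 * val x.2)
        = u * val x.2 * (v * (z.1 * val y.2)) by ring.
by rewrite e1 -e2; ring.
Qed.

Canonical loc_eqv_equiv :=
  EquivRel loc_eqv loc_eqv_refl loc_eqv_sym loc_eqv_trans.

Definition localization := {eq_quot loc_eqv}.

HB.instance Definition _ : EqQuotient _ loc_eqv localization :=
  EqQuotient.on localization.
HB.instance Definition _ := Choice.on localization.

Definition loc_frac (a : R) (s : S) : localization :=
  \pi_localization (a, s).

Lemma loc_fracP (a b : R) (s t : S) :
  loc_frac a s = loc_frac b t <->
  exists2 u, S u & u * (a * val t) = u * (b * val s).
Proof. by split=> [/eqmodP /loc_eqvP|h] //; apply/eqmodP/loc_eqvP. Qed.

Lemma loc_frac_surj (q : localization) : exists a s, q = loc_frac a s.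
Proof. by elim/quotW: q => -[a s]; exists a, s. Qed.

Definition loc_addf x y : frac :=
  (x.1 * val y.2 + y.1 * val x.2, loc_den_mul x.2 y.2).
Definition loc_oppf x : frac := (- x.1, x.2).
Definition loc_mulf x y : frac := (x.1 * y.1, loc_den_mul x.2 y.2).

Definition loc_add := lift_op2 localization loc_addf.
Definition loc_opp := lift_op1 localization loc_oppf.
Definition loc_mul := lift_op2 localization loc_mulf.

Lemma repr_loc_frac x :
  exists2 u, S u & u * ((repr (\pi_localization x)).1 * val x.2)
                 = u * (x.1 * val (repr (\pi_localization x)).2).
Proof. by apply/loc_eqvP/eqmodP; rewrite reprK. Qed.

Lemma loc_addE a b s t : loc_add (loc_frac a s) (loc_frac b t)
  = loc_frac (a * val t + b * val s) (loc_den_mul s t).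
Proof.
rewrite /loc_frac /loc_add; unlock.
have [u Su /= e1] := repr_loc_frac (a, s).
have [v Sv /= e2] := repr_loc_frac (b, t).
case: (repr _) e1 => a' s' /= e1; case: (repr _) e2 => b' t' /= e2.
apply/loc_fracP; exists (u * v); first exact: mS.2.
transitivity (v * val t' * val t * (u * (a' * val s))
            + u * val s' * val s * (v * (b' * val t))) => /=; first by ring.
by rewrite e1 e2; ring.
Qed.

Lemma loc_oppE a s : loc_opp (loc_frac a s) = loc_frac (- a) s.
Proof.
rewrite /loc_frac /loc_opp; unlock.
have [u Su /= e1] := repr_loc_frac (a, s).
case: (repr _) e1 => a' s' /= e1; apply/loc_fracP; exists u => //=.
by rewrite !mulNr !mulrN e1.
Qed.

Lemma loc_mulE a b s t : loc_mul (loc_frac a s) (loc_frac b t)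
  = loc_frac (a * b) (loc_den_mul s t).
Proof.
rewrite /loc_frac /loc_mul; unlock.
have [u Su /= e1] := repr_loc_frac (a, s).
have [v Sv /= e2] := repr_loc_frac (b, t).
case: (repr _) e1 => a' s' /= e1; case: (repr _) e2 => b' t' /= e2.
apply/loc_fracP; exists (u * v); first exact: mS.2.
transitivity ((u * (a' * val s)) * (v * (b' * val t))) => /=; first by ring.
by rewrite e1 e2; ring.
Qed.

Let loc_frac_eq (a b : R) (s t : S) :
  a * val t = b * val s -> loc_frac a s = loc_frac b t.
Proof. by move=> e; apply/loc_fracP; exists 1; [exact: mS.1|rewrite e]. Qed.

Lemma loc_addA : associative loc_add.
Proof.
move=> p q r; have [a [s ->]] := loc_frac_surj p.
have [b [t ->]] := loc_frac_surj q; have [c [w ->]] := loc_frac_surj r.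
by rewrite !loc_addE; apply: loc_frac_eq => /=; ring.
Qed.

Lemma loc_addC : commutative loc_add.
Proof.
move=> p q; have [a [s ->]] := loc_frac_surj p.
have [b [t ->]] := loc_frac_surj q.
by rewrite !loc_addE; apply: loc_frac_eq => /=; ring.
Qed.

Lemma loc_add0 : left_id (loc_frac 0 loc_one) loc_add.
Proof.
move=> p; have [a [s ->]] := loc_frac_surj p.
by rewrite !loc_addE; apply: loc_frac_eq => /=; ring.
Qed.

Lemma loc_addN : left_inverse (loc_frac 0 loc_one) loc_opp loc_add.
Proof.
move=> p; have [a [s ->]] := loc_frac_surj p.
by rewrite loc_oppE !loc_addE; apply: loc_frac_eq => /=; ring.
Qed.

HB.instance Definition _ :=
  GRing.isZmodule.Build localization loc_addA loc_addC loc_add0 loc_addN.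

Lemma loc_mulA : associative loc_mul.
Proof.
move=> p q r; have [a [s ->]] := loc_frac_surj p.
have [b [t ->]] := loc_frac_surj q; have [c [w ->]] := loc_frac_surj r.
by rewrite !loc_mulE; apply: loc_frac_eq => /=; ring.
Qed.

Lemma loc_mulC : commutative loc_mul.
Proof.
move=> p q; have [a [s ->]] := loc_frac_surj p.
have [b [t ->]] := loc_frac_surj q.
by rewrite !loc_mulE; apply: loc_frac_eq => /=; ring.
Qed.

Lemma loc_mul1 : left_id (loc_frac 1 loc_one) loc_mul.
Proof.
move=> p; have [a [s ->]] := loc_frac_surj p.
by rewrite !loc_mulE; apply: loc_frac_eq => /=; ring.
Qed.

Lemma loc_mulDl : left_distributive loc_mul loc_add.
Proof.
move=> p q r; have [a [s ->]] := loc_frac_surj p.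
have [b [t ->]] := loc_frac_surj q; have [c [w ->]] := loc_frac_surj r.
by rewrite !(loc_mulE, loc_addE); apply: loc_frac_eq => /=; ring.
Qed.

HB.instance Definition _ := GRing.Zmodule_isComPzRing.Build localization
  loc_mulA loc_mulC loc_mul1 loc_mulDl.

End Localization.

(* Main.v *)
(** An [S]-stationarity index [k >= 1] of the chain of the ideals [a ^ n R],
    read at [n = 2 k], says [s a ^ k \in a ^ (2 k) R]; the element [s] is kept,
    which gives the uniform version as well.  In the localization,
    [t a ^ n = a ^ (2 n) b] becomes
    [(a / s) ^ n = (b s ^ n / t) (a / s) ^ (2 n)], and conversely
    [(a / 1) ^ n = (x / t) (a / 1) ^ (2 n)] means
    [(u t) a ^ n = a ^ (2 n) (u x)] for some [u] in [S]. *)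
Require Import Defs.
From HB Require Import structures.
From mathcomp Require Import all_boot all_algebra.
From mathcomp Require Import boolp classical_sets.
From mathcomp Require Import ring.

Lemma descending_principal_powers (R : comPzRingType) (a : R) :
  descending_ideals (fun n => [set (a ^+ n * r)%R | r in [set: R]])%classic.
Proof.
split=> [n|n _ [r _ <-]]; last by exists (a * r)%R => //; rewrite GRing.exprS; ring.
split=> [|_ _ [r _ <-] [r' _ <-]|c _ [r _ <-]].
- by exists 0%R => //; ring.
- by exists (r + r')%R => //; ring.
- by exists (c * r)%R => //; ring.
Qed.

Lemma stationary_S_pi_regular_wrt (R : comPzRingType) (s a : R) :
  S_stationary_wrt s
    (fun n => [set (a ^+ n * r)%R | r in [set: R]])%classic ->
  S_pi_regular_wrt s a.
Proof.
move=> [k [k_gt0 /(_ (2 * k))]].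
case/(_ (leq_pmull _ _) (s * a ^+ k)%R) => //.
  (* The generator [a ^+ k], with coefficient 1, is the element of the [k]-th ideal that [s]
     multiplies. *)
  by exists (a ^+ k)%R => //; exists 1%R => //; ring.
by move=> b _ e; exists b, k.
Qed.

(** Denominators live in the subtype of [S], which carries no power operation, so the new
    denominator [p] is pinned down by its value in [R]. *)
Lemma loc_frac_exp (R : comPzRingType) (S : set R)
    (mS : multiplicative_subset S) (a : R) (s : S) (n : nat) :
  exists2 p : S, val p = (val s ^+ n)%R
    & (loc_frac mS a s ^+ n)%R = loc_frac mS (a ^+ n)%R p.
Proof.
elim: n => [|n [p pE IHn]]; first by exists (loc_one mS).
exists (loc_den_mul mS s p); first by rewrite /= pE GRing.exprS.
by rewrite !GRing.exprS IHn; apply: loc_mulE.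
Qed.

Lemma S_pi_regular_localization (R : comPzRingType) (S : set R)
    (mS : multiplicative_subset S) :
  (forall a : R, S_pi_regular S a) <-> pi_regular_ring (localization mS).
Proof.
split=> [regS q|reg a].
  have [a [s ->]] := loc_frac_surj q.
  have [t St [b [n [n_gt0 e]]]] := regS a.
  exists n, (loc_frac mS (b * val s ^+ n)%R (exist _ t (mem_set St))).
  split=> //.
  have [p pE ->] := loc_frac_exp R S mS a s n.
  have [p2 p2E ->] := loc_frac_exp R S mS a s (2 * n).
  (* The ring product of the localization is [loc_mul] up to conversion. *)
  apply: (etrans _ (esym (loc_mulE _ _ _ _ _))).
  apply/loc_fracP; exists 1%R; first exact: mS.1.
  (* The cross products, with [x] for [val s], already agree in [R], whence the multiplier 1. *)
  have eX (x : R) : (1 * (a ^+ n * (t * x ^+ (2 * n))) =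
                     1 * (b * x ^+ n * a ^+ (2 * n) * x ^+ n))%R.
    transitivity (t * a ^+ n * x ^+ (2 * n))%R; first by ring.
    by rewrite e mul2n -addnn !GRing.exprD; ring.
  rewrite /= pE p2E; exact: eX.
have [n [q [n_gt0]]] := reg (loc_frac mS a (loc_one mS)).
have [x [t ->]] := loc_frac_surj q.
have [p pE ->] := loc_frac_exp R S mS a (loc_one mS) n.
have [p2 p2E ->] := loc_frac_exp R S mS a (loc_one mS) (2 * n).
move=> /(fun e => etrans e (loc_mulE _ _ _ _ _))/loc_fracP[u Su /=].
(* Both denominators are powers of 1, so only [val t] and the multiplier [u] survive. *)
rewrite pE p2E /= !GRing.expr1n => e.
exists (u * val t)%R; first by apply: mS.2 => //; exact: set_valP.
exists (u * x)%R, n; split=> //.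
transitivity (u * (a ^+ n * (val t * 1)))%R; first by ring.
by rewrite e; ring.
Qed.

Theorem proposition3p9 (R : comPzRingType) (S : set R)
    (mS : multiplicative_subset S) :
  [/\ S_Artinian S ->
        (forall a : R, S_pi_regular S a) /\ pi_regular_ring (localization mS),
      (forall a : R, S_pi_regular S a) <-> pi_regular_ring (localization mS)
    & uniformly_S_Artinian S -> uniformly_S_pi_regular S].
Proof.
split; [move=> artS|exact: S_pi_regular_localization|].
  suff regS a : S_pi_regular S a.
    by split=> //; apply/S_pi_regular_localization.
  (* Here [s] depends on [a] through the chain; in the uniform case it is fixed before [a]. *)
  have [s Ss statS] := artS _ (descending_principal_powers R a).
  by exists s => //; apply: stationary_S_pi_regular_wrt.
move=> [s Ss statS]; exists s => // a.
apply: stationary_S_pi_regular_wrt; apply: statS.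
exact: descending_principal_powers.
Qed.
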